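(* Every spanning tree auxiliary graph has infinitely many preimages: if $H\cong Aux(G)$ for some finite simple connected graph $G$, then there are infinitely many pairwise non-isomorphic finite simple connected graphs $G'$ with $Aux(G')\cong H$, and such graphs may be obtained by adding any number of $K_2$ blocks to $G$.
   Context: For a finite simple connected graph $G$ on $n$ vertices, the spanning tree auxiliary graph $Aux(G)$ is the graph whose vertices are the spanning trees of $G$, two spanning trees being adjacent if and only if one is obtained from the other by a single unit transformation, i.e. by adding one edge of $G$ not in the tree and deleting a different edge so that the result is again a spanning tree; equivalently, the symmetric difference of their edge sets has exactly two edges (they share exactly $n-2$ of their $n-1$ edges). A block of a graph is a maximal 2-connected subgraph, where a graph is 2-connected if it cannot be disconnected by deleting fewer than two vertices ($K_2$ counts as 2-connected). Adding a $K_2$ block to a graph means adding one new vertex together with one edge joining it to an existing vertex. *)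

(* Defs.v *)
From mathcomp Require Import all_boot.

Set Implicit Arguments.
Unset Strict Implicit.
Unset Printing Implicit Defensive.

Record sgraph := SGraph {
  vertex :> finType;
  adj : rel vertex;
  adj_sym : symmetric adj;
  adj_irrefl : irreflexive adj }.

Definition iso (G H : sgraph) : Prop :=
  exists2 f : G -> H, bijective f & {mono f : x y / adj x y}.

(* A connected graph has at least one vertex. *)
Definition connected (G : sgraph) : bool :=
  (0 < #|G|) && [forall x : G, forall y : G, connect (@adj G) x y].

(* The bound on the length only serves to make the quantifier range over a
   finite type: see acyclicP. The size-2 cycles [:: x; y] of path.v traverse the
   same edge twice, hence are not cycles in the graph-theoretic sense. *)
Definition acyclic (G : sgraph) : bool :=
  [forall n : 'I_(#|G|).+1, forall c : n.-tuple G,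
    ucycleb (@adj G) c ==> (size c < 3)].

Lemma acyclicP (G : sgraph) :
  reflect (forall c : seq G, ucycle (@adj G) c -> size c < 3) (acyclic G).
Proof.
apply: (iffP forallP) => [acG c cyc | acG n].
  have szc : size c < (#|G|).+1.
    by case/andP: (cyc) => _ /card_uniqP <-; rewrite ltnS max_card.
  by have /forallP/(_ (in_tuple c))/implyP := acG (Ordinal szc); apply.
by apply/forallP => c; apply/implyP; apply: acG.
Qed.

Definition is_tree (G : sgraph) : bool := connected G && acyclic G.

Definition edges (G : sgraph) : {set {set G}} :=
  [set e | [exists x : G, exists y : G, adj x y && (e == [set x; y])]].

Section SpanningSubgraph.
Variables (G : sgraph) (F : {set {set G}}).

Definition sub_adj : rel G := [rel x y | adj x y && ([set x; y] \in F)].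

Lemma sub_adj_sym : symmetric sub_adj.
Proof. by move=> x y; rewrite /sub_adj /= adj_sym setUC. Qed.

Lemma sub_adj_irrefl : irreflexive sub_adj.
Proof. by move=> x; rewrite /sub_adj /= adj_irrefl. Qed.

Definition spanning_subgraph : sgraph := SGraph sub_adj_sym sub_adj_irrefl.

End SpanningSubgraph.

Definition is_spanning_tree (G : sgraph) (T : {set {set G}}) : bool :=
  (T \subset edges G) && is_tree (spanning_subgraph T).

Definition spanning_tree (G : sgraph) : finType :=
  {T : {set {set G}} | is_spanning_tree T}.

Section Aux.
Variable G : sgraph.

(* That the result is again a spanning tree is carried by the type of T'. *)
Definition unit_transformation : rel (spanning_tree G) := [rel T T' |
  [exists e : {set G}, exists f : {set G},
    [&& e \in edges G :\: val T, f \in val T & val T' == (e |: val T) :\ f]]].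

Lemma unit_transformation_sym : symmetric unit_transformation.
Proof.
suff imp T T' : unit_transformation T T' -> unit_transformation T' T.
  by move=> T T'; apply/idP/idP; apply: imp.
case/existsP=> e /existsP[f /and3P[]]; rewrite inE => /andP[eT eG] fT /eqP T'E.
have nef : e != f by apply: contraNneq eT => ->.
have fG : f \in edges G by have /andP[/subsetP sTG _] := valP T; apply: sTG.
apply/existsP; exists f; apply/existsP; exists e.
rewrite T'E !(in_setD, in_setU, in_set1) !eqxx fG nef /=.
apply/eqP/setP => g; rewrite !inE.
have [->|_] := eqVneq g e; first by rewrite (negPf eT).
by have [->|_] := eqVneq g f.
Qed.

Lemma unit_transformation_irrefl : irreflexive unit_transformation.
Proof.
move=> T; apply/negbTE/negP => /existsP[e /existsP[f /and3P[_ fT /eqP TE]]].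
by move: fT; rewrite TE !inE eqxx.
Qed.

Definition Aux : sgraph :=
  SGraph unit_transformation_sym unit_transformation_irrefl.

End Aux.

Section AddK2.
Variables (G : sgraph) (v : G).

Definition add_K2_adj : rel (option G) := fun a b =>
  match a, b with
  | Some x, Some y => adj x y
  | Some x, None => x == v
  | None, Some y => y == v
  | None, None => false
  end.

Lemma add_K2_sym : symmetric add_K2_adj.
Proof. by case=> [x|] [y|] //=; apply: adj_sym. Qed.

Lemma add_K2_irrefl : irreflexive add_K2_adj.
Proof. by case=> [x|] //=; apply: adj_irrefl. Qed.

Definition add_K2 : sgraph := SGraph add_K2_sym add_K2_irrefl.

End AddK2.

(* add_K2_blocks G k G': G' results from G by successively adding k blocks K_2,
   each at an arbitrary vertex of the graph built so far. *)
Inductive add_K2_blocks (G : sgraph) : nat -> sgraph -> Prop :=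
  | add_K2_blocks0 : add_K2_blocks G 0 G
  | add_K2_blocksS k (G' : sgraph) (v : G') :
      add_K2_blocks G k G' -> add_K2_blocks G k.+1 (add_K2 v).

(* Main.v *)
Require Import Defs.
From mathcomp Require Import all_boot.

Set Implicit Arguments.
Unset Strict Implicit.
Unset Printing Implicit Defensive.

(** A pendant edge is a bridge, so it lies in every spanning tree and can never
    take part in an exchange of edges. Hence, if G' is G with a pendant edge p
    attached at v, the map T |-> T + p is a bijection from the spanning trees of
    G to those of G' ([is_spanning_tree_lift], [lift_restrict]), and it
    preserves and reflects the unit transformations
    ([unit_transformation_lift]); so Aux G' and Aux G are isomorphic
    ([Aux_add_K2]). That T + p is a spanning tree exactly when T is one reduces
    to the fact that attaching a pendant edge to any graph changes neither its
    connectedness nor its acyclicity ([is_tree_add_K2]), applied to the graph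
    with edge set T. Iterating gives every graph obtained by adding K_2 blocks;
    these are pairwise non-isomorphic as soon as the numbers of blocks differ,
    since each block adds one vertex. *)

(** * Isomorphisms and homomorphisms *)

Lemma iso_sym (G H : sgraph) : iso G H -> iso H G.
Proof.
case=> f [g fK gK] fM; exists g; first by exists f.
by move=> x y; rewrite -fM !gK.
Qed.

Lemma iso_trans (G H K : sgraph) : iso G H -> iso H K -> iso G K.
Proof.
case=> f bf fM [g bg gM]; exists (g \o f); first exact: bij_comp.
by move=> x y; rewrite /= gM fM.
Qed.

Lemma iso_card (G H : sgraph) : iso G H -> #|G| = #|H|.
Proof. by case=> f bf _; apply: bij_eq_card bf. Qed.

(** Edges may be sent to walks rather than to edges: the retraction that folds a
    pendant vertex onto its neighbour collapses the pendant edge. *)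
Lemma connect_homo (G H : sgraph) (f : G -> H) :
    (forall x y, adj x y -> connect (@adj H) (f x) (f y)) ->
  forall x y, connect (@adj G) x y -> connect (@adj H) (f x) (f y).
Proof.
move=> fM x y /connectP[p + ->].
elim: p x => [|z p IHp] x /= => [_|/andP[xz /IHp]]; first exact: connect0.
exact/connect_trans/fM.
Qed.

Lemma ucycle_map (G H : sgraph) (f : G -> H) (c : seq G) :
    injective f -> {mono f : x y / adj x y} ->
  ucycle (@adj H) (map f c) = ucycle (@adj G) c.
Proof.
move=> f_inj fM; rewrite /ucycle /ucycleb map_inj_uniq // cycle_map.
by rewrite (eq_cycle fM).
Qed.

Lemma acyclic_mono (G H : sgraph) (f : G -> H) :
    injective f -> {mono f : x y / adj x y} -> acyclic H -> acyclic G.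
Proof.
move=> f_inj fM /acyclicP acH; apply/acyclicP => c.
by rewrite -(ucycle_map c f_inj fM) => /acH; rewrite size_map.
Qed.

Lemma iso_is_tree (G H : sgraph) : iso G H -> is_tree G = is_tree H.
Proof.
suff imp (K L : sgraph) : iso K L -> is_tree K -> is_tree L.
  by move=> GH; apply/idP/idP; apply: imp => //; apply: iso_sym.
move=> KL; have [f [g fK gK] fM] := KL.
case/andP=> /andP[K0 /forallP cK] acK; apply/andP; split; last first.
  by apply: (acyclic_mono (can_inj gK)) acK => x y; rewrite -fM !gK.
rewrite /connected -(iso_card KL) K0; apply/forallP => x; apply/forallP => y.
rewrite -(gK x) -(gK y).
apply: connect_homo (forallP (cK (g x)) (g y)) => a b ab.
by apply: connect1; rewrite fM.
Qed.

(** * Attaching a pendant edge to a graph *)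

Section PendantEdge.
Variables (G : sgraph) (v : G).

Lemma connected_add_K2 : connected (add_K2 v) = connected G.
Proof.
apply/andP/andP => [[_ /forallP cG'] | [_ /forallP cG]]; split.
- by apply/card_gt0P; exists v.
- apply/forallP => x; apply/forallP => y.
  apply: (@connect_homo (add_K2 v) G (odflt v) _ (Some x) (Some y)); last first.
    exact: (forallP (cG' (Some x))).
  by case=> [a|] [b|] //= => [/connect1 // | /eqP-> | /eqP->]; apply: connect0.
- by apply/card_gt0P; exists None.
have csym : connect_sym (@adj (add_K2 v)) by apply/sym_connect_sym/add_K2_sym.
have to_v (a : add_K2 v) : connect (@adj (add_K2 v)) a (Some v).
  case: a => [x|]; last by apply: connect1; rewrite /= eqxx.
  apply: connect_homo (forallP (cG x) v) => a b ab; exact: connect1.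
apply/forallP => a; apply/forallP => b.
by apply: connect_trans (to_v a) _; rewrite csym.
Qed.

(** The two neighbours of a vertex on a cycle of length at least 3 are distinct,
    so a vertex of degree 1 lies on no such cycle. *)
Lemma pendant_not_on_ucycle (c : seq (add_K2 v)) :
  ucycle (@adj (add_K2 v)) c -> 2 < size c -> None \notin c.
Proof.
move=> cyc sz; apply/negP => /rot_to[i s def_c].
have: ucycle (@adj (add_K2 v)) (None :: s).
  by rewrite -def_c /ucycle /ucycleb rot_cycle rot_uniq.
have {sz def_c}: 2 < size (None :: s) by rewrite -def_c size_rot.
case: s => [|x s] //; case: (lastP s) => [|{}s y] // _.
case/andP=> /= /andP[Nx]; rewrite rcons_path last_rcons => /andP[_ yN] /and3P[_].
by case: x y Nx yN => [x|] [y|] //= /eqP-> /eqP->; rewrite mem_rcons mem_head.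
Qed.

Lemma acyclic_add_K2 : acyclic (add_K2 v) = acyclic G.
Proof.
apply/idP/idP => [|/acyclicP acG].
  exact: (@acyclic_mono _ (add_K2 v) Some (@Some_inj _)).
apply/acyclicP => c cyc; rewrite ltnNge; apply/negP => sz.
have c_Some : c = map Some (pmap id c).
  have idK : ocancel (@id (option G)) Some by case.
  rewrite (pmap_filter idK).
  have /all_filterP-> // : all isSome c.
  apply/allP => -[x|] // /idPn[]; exact: pendant_not_on_ucycle.
move: cyc sz; rewrite c_Some (@ucycle_map _ (add_K2 v) _ _ (@Some_inj _)) //.
by rewrite size_map => /acG; rewrite ltnNge => /negP.
Qed.

Lemma is_tree_add_K2 : is_tree (add_K2 v) = is_tree G.
Proof. by rewrite /is_tree connected_add_K2 acyclic_add_K2. Qed.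

End PendantEdge.

(** * Edge sets and spanning trees of the extended graph *)

Section Lift.
Variables (G : sgraph) (v : G).

Definition lift_edge (e : {set G}) : {set add_K2 v} := Some @: e.

Definition pendant : {set add_K2 v} := [set Some v; None].

Definition lift (T : {set {set G}}) : {set {set add_K2 v}} :=
  pendant |: lift_edge @: T.

Definition restrict (S : {set {set add_K2 v}}) : {set {set G}} :=
  lift_edge @^-1: S.

Lemma lift_edge_inj : injective lift_edge.
Proof. exact/imset_inj/Some_inj. Qed.

Lemma lift_edge2 x y : lift_edge [set x; y] = [set Some x; Some y].
Proof. by rewrite /lift_edge imsetU !imset_set1. Qed.

Lemma lift_edge_neq e : lift_edge e != pendant.
Proof.
apply/eqP => /setP/(_ None); rewrite !inE orbT.
by case/imsetP.
Qed.

Lemma pendant_lift T : pendant \in lift T.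
Proof. exact: setU11. Qed.

Lemma mem_lift e T : (lift_edge e \in lift T) = (e \in T).
Proof.
by rewrite in_setU1 (negPf (lift_edge_neq e)) (mem_imset _ _ lift_edge_inj).
Qed.

Lemma liftK : cancel lift restrict.
Proof. by move=> T; apply/setP => e; rewrite inE mem_lift. Qed.

Lemma edgesP (K : sgraph) (e : {set K}) :
  reflect (exists x y, adj x y /\ e = [set x; y]) (e \in edges K).
Proof.
rewrite inE; apply: (iffP existsP) => [[x /existsP[y /andP[xy /eqP->]]]|].
  by exists x, y.
by case=> x [y [xy ->]]; exists x; apply/existsP; exists y; rewrite xy eqxx.
Qed.

Lemma edges_add_K2 : edges (add_K2 v) = lift (edges G).
Proof.
apply/setP => e; apply/edgesP/setU1P => [[[x|] [[y|] [//= xy ->]]]|].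
- right; apply/imsetP; exists [set x; y]; last by rewrite lift_edge2.
  by apply/edgesP; exists x, y.
- by left; rewrite (eqP xy).
- by left; rewrite (eqP xy) setUC.
case=> [->|/imsetP[_ /edgesP[x [y [xy ->]]] ->]].
  by exists (Some v), None; rewrite /= eqxx.
by exists (Some x), (Some y); rewrite lift_edge2.
Qed.

Lemma lift_sub_edges T : (lift T \subset edges (add_K2 v)) = (T \subset edges G).
Proof.
rewrite edges_add_K2; apply/subsetP/subsetP => sT e.
  by rewrite -mem_lift => /sT; rewrite mem_lift.
case/setU1P=> [->|/imsetP[f /sT fG ->]]; first exact: pendant_lift.
by rewrite mem_lift.
Qed.

(** Lifting an edge set commutes with attaching the pendant edge. *)
Lemma spanning_subgraph_lift T :
  iso (spanning_subgraph (lift T)) (@add_K2 (spanning_subgraph T) v).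
Proof.
exists id; first by exists id.
move=> [x|] [y|] //=; rewrite /sub_adj /=.
- by rewrite -lift_edge2 mem_lift.
- by have [->|] := eqVneq x v; rewrite ?pendant_lift.
by have [->|] := eqVneq y v; rewrite // setUC pendant_lift.
Qed.

Lemma is_spanning_tree_lift T : is_spanning_tree (lift T) = is_spanning_tree T.
Proof.
rewrite /is_spanning_tree lift_sub_edges (iso_is_tree (spanning_subgraph_lift T)).
by rewrite is_tree_add_K2.
Qed.

(** A walk from the pendant vertex to v inside the tree has to leave along the
    pendant edge. *)
Lemma pendant_spanning_tree (S : {set {set add_K2 v}}) :
  is_spanning_tree S -> pendant \in S.
Proof.
case/and3P=> _ /andP[_ /forallP/(_ None)/forallP/(_ (Some v))] /connectP[p].
case: p => [|[x|] p] //= /andP[+ _] _ _.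
by rewrite /sub_adj /= => /andP[/eqP->]; rewrite setUC.
Qed.

Lemma lift_restrict (S : {set {set add_K2 v}}) :
  is_spanning_tree S -> lift (restrict S) = S.
Proof.
move=> treeS; have pS := pendant_spanning_tree treeS.
have /andP[/subsetP sS _] := treeS.
apply/setP => e; apply/setU1P/idP => [[->//|/imsetP[f]] | eS].
  by rewrite inE => fS ->.
have := sS e eS; rewrite edges_add_K2 => /setU1P[|/imsetP[f _ def_e]]; first by left.
by right; rewrite def_e imset_f // inE -def_e.
Qed.

(** * The isomorphism of auxiliary graphs *)

Definition lift_tree (T : Aux G) : Aux (add_K2 v) :=
  Sub (lift (val T)) (etrans (is_spanning_tree_lift (val T)) (valP T)).

Lemma lift_tree_bij : bijective lift_tree.
Proof.
have treeR (S : Aux (add_K2 v)) : is_spanning_tree (restrict (val S)).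
  by rewrite -is_spanning_tree_lift lift_restrict (valP S).
exists (fun S => Sub (restrict (val S)) (treeR S)) => [T|S]; apply: val_inj.
  exact: liftK.
exact: lift_restrict (valP S).
Qed.

Lemma lift_exchange T e f :
  lift ((e |: T) :\ f) = (lift_edge e |: lift T) :\ lift_edge f.
Proof.
apply/setP => g; have [->|ng] := eqVneq g pendant.
  by rewrite pendant_lift !inE eqxx eq_sym lift_edge_neq orbT.
have [/imsetP[h _ ->]|notG] := boolP (g \in lift_edge @: setT).
  rewrite mem_lift !in_setD1 [in RHS]in_setU1 mem_lift in_setU1.
  by rewrite !(inj_eq lift_edge_inj).
have notT (U : {set {set G}}) : g \in lift U = false.
  apply: contraNF notG => /setU1P[gp|/imsetP[h _ ->]]; last exact: imset_f.
  by rewrite gp eqxx in ng.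
rewrite notT in_setD1 in_setU1 notT orbF andbC.
by case: eqP notG => // ->; rewrite imset_f.
Qed.

(** The pendant edge lies in both lifted trees, so it is neither the edge added
    nor the edge deleted: both of these come from G. *)
Lemma unit_transformation_lift : {mono lift_tree : T T' / adj T T'}.
Proof.
move=> T T'; apply/existsP/existsP => -[e /existsP[f /and3P[]]].
  rewrite !SubK edges_add_K2 in_setD => /andP[eT eG] fT /eqP T'E.
  have [e0 e0G def_e] : exists2 e0, e0 \in edges G & e = lift_edge e0.
    case/setU1P: eG eT => [->|/imsetP[e0 ? ->] _]; last by exists e0.
    by rewrite pendant_lift.
  have [f0 f0T def_f] : exists2 f0, f0 \in val T & f = lift_edge f0.
    case/setU1P: fT T'E => [-> T'E|/imsetP[f0 ? ->] _]; last by exists f0.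
    by have := pendant_lift (val T'); rewrite T'E !inE eqxx.
  exists e0; apply/existsP; exists f0.
  rewrite in_setD e0G f0T -mem_lift -def_e eT /=.
  by rewrite -(inj_eq (can_inj liftK)) lift_exchange -def_e -def_f T'E.
rewrite in_setD => /andP[eT eG] fT /eqP T'E.
exists (lift_edge e); apply/existsP; exists (lift_edge f).
by rewrite !SubK edges_add_K2 in_setD !mem_lift eT eG fT T'E lift_exchange eqxx.
Qed.

Lemma Aux_add_K2 : iso (Aux (add_K2 v)) (Aux G).
Proof.
apply: iso_sym; exists lift_tree; first exact: lift_tree_bij.
exact: unit_transformation_lift.
Qed.

End Lift.

(** * Adding any number of blocks *)

Lemma add_K2_blocks_Aux (G : sgraph) k (G' : sgraph) : add_K2_blocks G k G' ->
  connected G -> connected G' /\ iso (Aux G') (Aux G).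
Proof.
move=> blocks G_conn; elim: k G' / blocks => [|k G' v _ [G'_conn G'_Aux]].
  by split=> //; exists id; first exists id.
by split; [rewrite connected_add_K2 | apply: iso_trans (Aux_add_K2 v) G'_Aux].
Qed.

Lemma add_K2_blocks_card (G : sgraph) k (G' : sgraph) :
  add_K2_blocks G k G' -> #|G'| = #|G| + k.
Proof.
elim: k G' / => [|k G' v _ IH]; first by rewrite addn0.
by rewrite card_option IH addnS.
Qed.

(** Carrying a vertex along with each graph provides the place where the next
    block is attached: here a path grows from the vertex [v]. *)
Definition grow_path (G : sgraph) (v : G) (k : nat) : {K : sgraph & K} :=
  iter k (fun Kw => existT (fun K : sgraph => K) (add_K2 (projT2 Kw)) None)
    (existT (fun K : sgraph => K) G v).

Lemma grow_path_blocks (G : sgraph) (v : G) k :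
  add_K2_blocks G k (projT1 (grow_path v k)).
Proof. by elim: k => [|k IH] /=; constructor. Qed.

Theorem mainTheorem4 (H G : sgraph) (G_conn : connected G)
    (H_Aux : iso H (Aux G)) :
  (exists G_ : nat -> sgraph,
     [/\ forall k, add_K2_blocks G k (G_ k),
         forall k, connected (G_ k),
         forall k, iso (Aux (G_ k)) H
       & forall j k, j <> k -> ~ iso (G_ j) (G_ k)])
  /\
  (forall (k : nat) (G' : sgraph), add_K2_blocks G k G' ->
     connected G' /\ iso (Aux G') H).
Proof.
have blocks_Aux k G' : add_K2_blocks G k G' -> connected G' /\ iso (Aux G') H.
  move=> /add_K2_blocks_Aux/(_ G_conn)[G'_conn G'_Aux]; split=> //.
  exact: iso_trans G'_Aux (iso_sym H_Aux).
split=> //; have /andP[/card_gt0P[v _] _] := G_conn.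
exists (fun k => projT1 (grow_path v k)); split=> [k|k|k|j k neq_jk jk].
- exact: grow_path_blocks.
- by have [] := blocks_Aux _ _ (grow_path_blocks v k).
- by have [] := blocks_Aux _ _ (grow_path_blocks v k).
apply: neq_jk; apply/eqP; rewrite -(eqn_add2l #|G|).
by rewrite -!(add_K2_blocks_card (grow_path_blocks v _)) (iso_card jk).
Qed.
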